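(* After a suitable rotation, the truncated octahedron in $\mathbb{R}^3$ can be decomposed into four octahedra (convex polytopes with exactly 8 faces, not necessarily regular) with orthogonally connected boundaries.
   Context: A polygonal path in $\mathbb{R}^3$ is orthogonal if each of its edges is parallel to one of the coordinate axes. A set $S\subset\mathbb{R}^3$ is orthogonally connected if any two distinct points of $S$ are joined by an orthogonal path contained in $S$. A polytope is decomposed into polytopes $P_1,\dots,P_k$ if it is their union and their interiors are pairwise disjoint. Faces are the 2-dimensional faces. ''After a suitable rotation'' means that there is a rotation of $\mathbb{R}^3$ such that the image of the polytope has the stated property with respect to the fixed coordinate axes. The truncated octahedron is the Archimedean solid which is, up to similarity, the convex hull of all permutations of $(0,\pm1,\pm2)$ (6 square and 8 regular hexagonal faces). *)

(* Defs.v *)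
From HB Require Import structures.
From mathcomp Require Import all_boot all_order all_algebra all_fingroup.
From mathcomp Require Import all_classical all_reals all_analysis.
Import Order.TTheory GRing.Theory Num.Theory.
Import numFieldNormedType.Exports.

Set Implicit Arguments.
Unset Strict Implicit.
Unset Printing Implicit Defensive.

Local Open Scope classical_set_scope.
Local Open Scope ring_scope.

(* Points of R^n are row vectors.  Their topology is the one of the sup norm,
   which coincides with the Euclidean topology. *)

Section Polytopes.
Context {R : realType} {n : nat}.
Implicit Types (P S V F : set 'rV[R]_n) (x y u : 'rV[R]_n).

Definition dot u x : R := \sum_i u 0 i * x 0 i.

Definition segment x y : set 'rV[R]_n :=
  [set x + t *: (y - x) | t in `[0, 1]%classic].

Definition boundary S : set 'rV[R]_n := closure S `\` interior S.

Definition convex_hull V : set 'rV[R]_n := smallest (@convex_set R _) V.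

(* Polytopes are convex and full-dimensional. *)
Definition polytope P : Prop :=
  (exists2 V, finite_set V & P = convex_hull V) /\ interior P !=set0.

Definition affinely_independent k (p : 'I_k.+1 -> 'rV[R]_n) : bool :=
  row_free (\matrix_(i < k) (p (lift ord0 i) - p ord0)).

Definition has_affine_dim S (k : nat) : Prop :=
  (exists2 p : 'I_k.+1 -> 'rV[R]_n,
     affinely_independent p & forall i, S (p i)) /\
  ~ (exists2 p : 'I_k.+2 -> 'rV[R]_n,
     affinely_independent p & forall i, S (p i)).

(* The k-dimensional faces of P: its k-dimensional intersections with
   supporting hyperplanes. *)
Definition faces (k : nat) P : set (set 'rV[R]_n) :=
  [set F | has_affine_dim F k /\
     exists u (b : R),
       [/\ u != 0, P `<=` [set x | dot u x <= b] &
           F = P `&` [set x | dot u x = b]]].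

Definition decomposed_into k P (Q : 'I_k -> set 'rV[R]_n) : Prop :=
  [/\ forall i, polytope (Q i),
      P = \bigcup_i Q i &
      trivIset setT (fun i => interior (Q i))].

Definition axis_parallel x y : Prop :=
  exists (i : 'I_n) (c : R), c != 0 /\ y - x = c *: delta_mx 0 i.

(* [p 0], ..., [p k] are the successive vertices of the path. *)
Definition orthogonal_path_in S x y : Prop :=
  exists (k : nat) (p : nat -> 'rV[R]_n),
    [/\ p 0%N = x, p k = y &
        forall i, (i < k)%N ->
          axis_parallel (p i) (p i.+1) /\ segment (p i) (p i.+1) `<=` S].

Definition orthogonally_connected S : Prop :=
  forall x y, S x -> S y -> x != y -> orthogonal_path_in S x y.

Definition orthogonal_mx (Q : 'M[R]_n) : Prop := Q *m Q^T = 1%:M.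

Definition rotation_mx (Q : 'M[R]_n) : Prop := orthogonal_mx Q /\ \det Q = 1.

End Polytopes.

Section TruncatedOctahedron.
Context {R : realType}.
Implicit Types (P T : set 'rV[R]_3).

Definition octahedron P : Prop := polytope P /\ (faces 2 P #= `I_8)%card.

Definition std_truncated_octahedron : set 'rV[R]_3 :=
  convex_hull
    [set v | exists (s : 'S_3) (a b : bool),
       v = col_perm s (\row_(i < 3) [:: 0; (-1) ^+ a; (-1) ^+ b * 2]`_i)].

Definition truncated_octahedron T : Prop :=
  exists (c : R) (Q : 'M[R]_3) (t : 'rV[R]_3),
    [/\ 0 < c, orthogonal_mx Q &
        T = [set c *: (x *m Q) + t | x in std_truncated_octahedron]].

End TruncatedOctahedron.

(* Main.v *)
Require Import Defs.
From mathcomp Require Import all_boot all_order all_algebra all_fingroup.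
From mathcomp Require Import all_classical all_reals all_analysis.
From mathcomp Require Import ring lra.
Import Order.TTheory GRing.Theory Num.Theory.
Import numFieldNormedType.Exports.
Local Open Scope classical_set_scope.
Local Open Scope ring_scope.

Set Implicit Arguments.
Unset Strict Implicit.
Unset Printing Implicit Defensive.

(** Write the points of R^3 as (x, y, z).  Inside a face, an orthogonal path can
    only follow the coordinate directions orthogonal to the normal of the face,
    so the normal must have a zero coordinate, lest the interior points of the
    face be isolated.  The truncated octahedron acquires this property after an
    eighth of a turn about the z axis: in the coordinates X = x + y,
    Y = x - y, Z = z (orthogonal up to a diagonal rescaling, which is harmless
    for all notions involved) it becomes

      |X| + |Z| <= 3,  |Y| + |Z| <= 3,  |X| + |Y| <= 4,  |Z| <= 2.

    The planes X = 0 and Z = 0 cut it into four pieces, which are the images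
    under sign changes of X and Z of

      X >= 0,  0 <= Z <= 2,  X + Z <= 3,  |Y| + Z <= 3,  X + |Y| <= 4.

    These are eight inequalities, and each of them is the only tight one at
    some point, so the piece has exactly eight faces
    ([card_faces_polyhedron], [irredundant_quarter]).  Its boundary is
    orthogonally connected ([boundary_quarter_connected]): the faces Z = 2 and
    Y + Z = 3, Z - Y = 3 allow moves along X down to the wall X = 0, the faces
    X + Y = 4, X - Y = 4 allow moves along Z down to the floor Z = 0, and the
    face X + Z = 3 allows moves along Y up to one of those.  In the wall and in
    the floor two directions are available, and they lead to the origin.

    For the decomposition, both inclusions are needed between the convex hull
    of the 24 vertices and the union of the pieces.  One follows from the
    inequalities satisfied by the vertices ([std_bound]), the other one from
    the description of a piece as the hull of its 12 vertices
    ([quarter_sub_convex]).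

    An affine bijection maps a polyhedron to a polyhedron with the same slacks
    ([dot_affine_normal]).  Since interior, boundary and faces of a polyhedron
    can be read off from the slacks, these notions are transported to the four
    pieces, whatever the similarity that placed the solid in space.  Orthogonal
    paths are transported as well, because the linear parts of the maps from
    the piece above to the four pieces are diagonal
    ([orthogonally_connected_affine]). *)

(** * Scalar product *)

Section ScalarProduct.
Context {R : realType}.

Lemma small_scale (I : finType) (a c : I -> R) :
  (forall i, 0 < a i) -> exists2 e, 0 < e & forall i, e * c i <= a i.
Proof.
move=> a0; pose s := 1 + \sum_i `|c i| / a i.
have t0 i : 0 <= `|c i| / a i by rewrite divr_ge0 // ltW.
have s0 : 0 < s by rewrite ltr_pwDl // sumr_ge0.
exists s^-1; first by rewrite invr_gt0.
move=> i; rewrite mulrC ler_pdivrMr // mulrC -ler_pdivrMr //.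
apply: (@le_trans _ _ (`|c i| / a i)).
  by rewrite ler_pM2r ?invr_gt0 ?ler_norm.
by rewrite /s (bigD1 i) //= addrCA lerDl addr_ge0 // sumr_ge0.
Qed.

Context {n : nat}.
Implicit Types (u x y d : 'rV[R]_n).

Lemma dotE u x : dot u x = (x *m u^T) 0 0.
Proof. by rewrite mxE; apply: eq_bigr => i _; rewrite mxE mulrC. Qed.

Lemma dotDr u x y : dot u (x + y) = dot u x + dot u y.
Proof. by rewrite !dotE mulmxDl mxE. Qed.

Lemma dotZr u c x : dot u (c *: x) = c * dot u x.
Proof. by rewrite !dotE -scalemxAl mxE. Qed.

Lemma dotZl u c x : dot (c *: u) x = c * dot u x.
Proof. by rewrite !dotE linearZ /= -scalemxAr mxE. Qed.

Lemma dotNr u x : dot u (- x) = - dot u x.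
Proof. by rewrite !dotE mulNmx mxE. Qed.

Lemma dot_sumr u (I : finType) (x : I -> 'rV[R]_n) :
  dot u (\sum_i x i) = \sum_i dot u (x i).
Proof. by rewrite dotE mulmx_suml summxE; apply: eq_bigr => i _; rewrite dotE. Qed.

Lemma dotMl u (A : 'M[R]_n) x :
  dot (u *m A) x = dot u (x *m A^T).
Proof. by rewrite !dotE trmx_mul mulmxA. Qed.

Lemma dot_gt0 u : u != 0 -> 0 < dot u u.
Proof.
move=> u0; rewrite /dot lt_neqAle; apply/andP; split; last first.
  by apply: sumr_ge0 => i _; rewrite -expr2 sqr_ge0.
apply: contra u0; rewrite eq_sym => /eqP h; apply/eqP/rowP => i.
have /allP/(_ i) : all (fun i => true ==> (u 0 i * u 0 i == 0)) (index_enum 'I_n).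
  by rewrite -psumr_eq0 ?h // => j _; rewrite -expr2 sqr_ge0.
by rewrite mem_index_enum mxE mulf_eq0 orbb => /(_ isT)/eqP.
Qed.

Lemma continuous_dot u : continuous (dot u : 'rV[R]_n -> R).
Proof.
rewrite /dot; apply: continuous_big => [|i _]; first exact: add_continuous.
move=> x; apply: continuousM; first exact: cst_continuous.
exact: coord_continuous.
Qed.

Lemma interior_step (S : set 'rV[R]_n) x d :
  (interior S) x -> exists2 e, 0 < e & S (x + e *: d).
Proof.
move=> /nbhs_ballP[r /= r0 rS].
have [e e0 he] := @small_scale 'I_n (fun=> r / 2) (fun i => `|d 0 i|)
   (fun=> divr_gt0 r0 (ltr0Sn _ _)).
exists e => //; apply: rS; split=> // i j; rewrite ord1 /ball /= !mxE opprD addNKr normrN.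
rewrite normrM gtr0_norm //; apply: le_lt_trans (he j) _.
by rewrite ltr_pdivrMr // ltr_pMr // ltr1n.
Qed.

End ScalarProduct.

(** * Polyhedra and their faces *)

Section Polyhedra.
Context {R : realType} {n m : nat}.
Implicit Types (u : 'I_m -> 'rV[R]_n) (b : 'I_m -> R) (x y : 'rV[R]_n).

Definition polyhedron u b : set 'rV[R]_n :=
  [set x | forall i, dot (u i) x <= b i].

Definition facet u b i : set 'rV[R]_n :=
  polyhedron u b `&` [set x | dot (u i) x = b i].

Lemma polyhedron_convex u b :
  @convex_set R 'rV[R]_n (polyhedron u b).
Proof.
move=> x y t /set_mem xP /set_mem yP; apply/mem_set => i.
have -> : b i = t%:num * b i + (1 - t%:num) * b i by ring.
by rewrite dotDr !dotZr lerD // ler_wpM2l ?subr_ge0 // ?xP ?yP.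
Qed.

Lemma interior_polyhedron u b : (forall i, u i != 0) ->
  interior (polyhedron u b) = [set x | forall i, dot (u i) x < b i].
Proof.
move=> u0; apply/seteqP; split=> [x xP i|].
  have [e e0 /(_ i)] := interior_step (u i) xP.
  by apply: lt_le_trans; rewrite dotDr dotZr ltrDl mulr_gt0 ?dot_gt0.
rewrite -open_subsetE => [x xP i|]; first exact/ltW/xP.
rewrite openE => x xP.
apply: (filter_forall (nbhs_filter x)) => i.
have : open (dot (u i) @^-1` [set y | y < b i]).
  by apply: open_comp => [y _|]; [exact: continuous_dot|exact: open_lt].
by rewrite openE => /(_ x (xP i)).
Qed.

Lemma boundary_polyhedron u b : (forall i, u i != 0) ->
  boundary (polyhedron u b) =
  [set x | polyhedron u b x /\ exists i, dot (u i) x = b i].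
Proof.
move=> u0; rewrite /boundary interior_polyhedron //.
have -> : closure (polyhedron u b) = polyhedron u b.
  apply/esym/closure_id.
  have -> : polyhedron u b = \bigcap_i [set x | dot (u i) x <= b i].
    by apply/seteqP; split=> x h i => [_|]; apply: h.
  apply: closed_bigI => i _.
  apply: (@closed_comp _ _ (dot (u i)) [set y | y <= b i]) => [x _|].
    exact: continuous_dot.
  exact: closed_le.
apply/seteqP; split=> x [xP h]; split=> //.
  apply: contrapT => /forallNP ne; apply: h => i.
  by rewrite lt_neqAle xP andbT; apply/eqP.
by case: h => i e /(_ i); rewrite e ltxx.
Qed.

(** No inequality follows from the others: each one is the only tight one at
    some point.  Such a point lies in the relative interior of a facet, which
    makes it a witness both for the dimension of the facet and for its
    difference from the other ones. *)
Definition irredundant u b : Prop :=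
  (exists x, forall i, dot (u i) x < b i) /\
  (forall i, exists2 x,
     dot (u i) x = b i & forall j, j != i -> dot (u j) x < b j).

Lemma tight_normal_neq0 u b i : irredundant u b -> u i != 0.
Proof.
move=> [[x /(_ i) lt] tight]; have [y e _] := tight i.
by apply: contraTneq lt => u0; rewrite -e u0 -leNgt !dotE trmx0 !mulmx0.
Qed.

End Polyhedra.

Section Hyperplanes.
Context {R : realType} {k : nat}.

Lemma orthogonal_basis (v : 'rV[R]_k.+1) : v != 0 ->
  exists2 B : 'M[R]_(k, k.+1), row_free B & forall r, dot v (row r B) = 0.
Proof.
move=> v0; have rk : \rank (kermx v^T) = k.
  rewrite mxrank_ker mxrank_tr; have -> : \rank v = 1%N; last by rewrite subn1.
  by apply/eqP; rewrite eqn_leq rank_leq_row lt0n mxrank_eq0.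
have [] : exists2 B : 'M[R]_(\rank (kermx v^T), k.+1),
    row_free B & B *m v^T = 0.
  exists (row_base (kermx v^T)); first exact: row_base_free.
  by apply/sub_kermxP; rewrite eq_row_base.
rewrite rk => B Bf B0; exists B => // r.
by rewrite dotE -row_mul B0 !mxE.
Qed.

Lemma difference_mx_dot (v : 'rV[R]_k.+1) c l (p : 'I_l.+1 -> 'rV[R]_k.+1) :
  (forall i, dot v (p i) = c) ->
  (\matrix_(i < l) (p (lift ord0 i) - p ord0)) *m v^T = 0.
Proof.
move=> pv; apply/colP => i.
rewrite [RHS]mxE -[RHS](subrr c) -{1}(pv (lift ord0 i)) -(pv ord0) -dotNr -dotDr.
by rewrite dotE !mxE; apply: eq_bigr => j _; rewrite !mxE.
Qed.

(** The differences of k + 2 affinely independent points of R^(k+1) span the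
    space, and a normal to all of them vanishes. *)
Lemma hyperplane_dim (v : 'rV[R]_k.+1) c (p : 'I_k.+2 -> 'rV[R]_k.+1) :
  v != 0 -> affinely_independent p -> (forall i, dot v (p i) = c) -> False.
Proof.
move=> v0; rewrite /affinely_independent row_free_unit.
set M := \matrix_i _ => Mu pv; move/negP: v0; apply; apply/eqP.
have M0 : M *m v^T = 0 := difference_mx_dot pv.
by apply: trmx_inj; rewrite -(mulKmx Mu v^T) M0 mulmx0 trmx0.
Qed.

(** The normals to k independent directions of R^(k+1) form a line, so two
    affine functions that are constant on k + 1 affinely independent points
    have proportional gradients. *)
Lemma hyperplane_normal (v w : 'rV[R]_k.+1) (p : 'I_k.+1 -> 'rV[R]_k.+1) c d :
  v != 0 -> affinely_independent p ->
  (forall i, dot v (p i) = c) -> (forall i, dot w (p i) = d) ->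
  exists l, w = l *: v.
Proof.
move=> v0 + pv pw; rewrite /affinely_independent; set M := \matrix_i _ => pf.
have rk : \rank (kermx M^T) = 1%N.
  by rewrite mxrank_ker mxrank_tr (eqP pf) subSnn.
have sub z e : (forall i, dot z (p i) = e) -> (z <= kermx M^T)%MS.
  by move=> /difference_mx_dot z0; apply/sub_kermxP; apply: trmx_inj; rewrite trmx_mul trmxK z0 trmx0.
apply/sub_rVP.
apply: submx_trans (sub _ _ pw) _.
by rewrite -(geq_leqif (mxrank_leqif_sup (sub _ _ pv))) rk lt0n mxrank_eq0.
Qed.

End Hyperplanes.

Section Facets.
Context {R : realType} {k m : nat}.
Variables (u : 'I_m -> 'rV[R]_k.+1) (b : 'I_m -> R).
Hypothesis irr : irredundant u b.

Let tight := irr.2.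

Lemma facetI i x : dot (u i) x = b i ->
  (forall j, j != i -> dot (u j) x < b j) -> facet u b i x.
Proof.
move=> xi lt; split=> // j; have [->|ji] := eqVneq j i; first by rewrite xi.
exact/ltW/lt.
Qed.

Lemma facet_inj : injective (facet u b).
Proof.
move=> i j eqF; have [x xi lt] := tight i.
have : facet u b i x by exact: facetI.
rewrite eqF => -[_ /= xj]; apply/eqP/negP => /negP; rewrite eq_sym => /lt.
by rewrite xj ltxx.
Qed.

(** Small steps from the tight point along a basis of the hyperplane stay in
    the facet; [a] and [c] collect the slacks and the speeds at which they are
    consumed. *)
Lemma facet_dim i : has_affine_dim (facet u b i) k.
Proof.
have [x xi lt] := tight i; have u0 := tight_normal_neq0 i irr.
split; last by case=> p pf pF; exact: (hyperplane_dim u0 pf (fun j => (pF j).2)).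
have [B Bf B0] := orthogonal_basis u0.
pose a (jr : 'I_m * 'I_k) := if jr.1 == i then 1 else b jr.1 - dot (u jr.1) x.
pose c (jr : 'I_m * 'I_k) := if jr.1 == i then 0 else dot (u jr.1) (row jr.2 B).
have a0 jr : 0 < a jr.
  by rewrite /a; case: eqP => [|/eqP ne]; rewrite ?ltr01 ?subr_gt0 ?lt.
have [e e0 he] := @small_scale R _ a c a0.
exists (fun r => oapp (fun s => x + e *: row s B) x (unlift ord0 r)).
  rewrite /affinely_independent unlift_none /=.
  suff -> : \matrix_(r < k) (oapp (fun s => x + e *: row s B) x
       (unlift ord0 (lift ord0 r)) - x) = e *: B.
    by rewrite /row_free mxrank_scale_nz ?lt0r_neq0.
  by apply/matrixP => r s; rewrite mxE liftK /= !mxE addrAC subrr add0r.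
move=> r; case: (unliftP ord0 r) => [s _|_] /=.
  split; last by rewrite /= dotDr dotZr B0 mulr0 addr0.
  move=> j; have := he (j, s); rewrite /a /c /= dotDr dotZr.
  have [->|ji] := eqVneq j i; first by rewrite xi B0 mulr0 addr0.
  by rewrite -lerBrDl.
exact: facetI.
Qed.

(** One of the inequalities is tight at all the k + 1 affinely independent
    points of the face, hence its normal is proportional to the one of the
    supporting hyperplane. *)
Lemma face_is_facet F : faces k (polyhedron u b) F -> exists i, F = facet u b i.
Proof.
move=> [[[p pf pF] _] [v [c [v0 vP FE]]]].
have pP i : polyhedron u b (p i) by have := pF i; rewrite FE => -[].
have pc i : dot v (p i) = c by have := pF i; rewrite FE => -[].
have [i pi] : exists i, forall r, dot (u i) (p r) = b i.
  (* Otherwise every inequality is strict at one of the p r, hence at their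
     centroid g.  A small step from g in the direction v stays in the
     polyhedron and leaves the supporting half-space. *)
  apply: contrapT => /forallNP noi.
  pose g := (k.+1%:R)^-1 *: \sum_r p r.
  have k0 : (0 : R) < k.+1%:R^-1 by rewrite invr_gt0 ltr0Sn.
  have gE w : dot w g = k.+1%:R^-1 * \sum_r dot w (p r).
    by rewrite dotZr dot_sumr.
  have avg z : k.+1%:R^-1 * \sum_(r < k.+1) z = z :> R.
    by rewrite sumr_const card_ord -[z *+ _]mulr_natl mulrA mulVf ?mul1r // pnatr_eq0.
  have gc : dot v g = c by rewrite gE (eq_bigr _ (fun r _ => pc r)) avg.
  have glt i : dot (u i) g < b i.
    rewrite gE -[ltRHS]avg ltr_pM2l //; have /existsNP[r ne] := noi i.
    rewrite (bigD1 r) //= [ltRHS](bigD1 r) //= ltr_leD //.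
      by rewrite lt_neqAle pP andbT; apply/eqP.
    by apply: ler_sum => s _; apply: pP.
  have slack_gt0 i : 0 < b i - dot (u i) g by rewrite subr_gt0.
  have [e e0 he] := small_scale (fun i => dot (u i) v) slack_gt0.
  have /vP : polyhedron u b (g + e *: v).
    by move=> i; rewrite dotDr (dotZr _ e) -lerBrDl.
  by rewrite /= dotDr (dotZr _ e) gc gerDl leNgt mulr_gt0 ?dot_gt0.
have ui0 := tight_normal_neq0 i irr.
have [l vE] := hyperplane_normal ui0 pf pi pc.
have l0 : l != 0 by apply: contra_neq v0 => l0; rewrite vE l0 scale0r.
exists i; rewrite FE /facet; congr (_ `&` _); apply/seteqP.
have cE : c = l * b i by rewrite -(pc ord0) -(pi ord0) vE dotZl.
split=> x /=; rewrite vE dotZl cE; last by move->.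
exact: (mulfI l0).
Qed.

Lemma card_faces_polyhedron : (faces k (polyhedron u b) #= `I_m)%card.
Proof.
have -> : faces k (polyhedron u b) = facet u b @` setT.
  apply/seteqP; split=> [F /face_is_facet[i ->]|_ [i _ <-]]; first by exists i.
  split; first exact: facet_dim.
  exists (u i), (b i); split=> //; first exact: tight_normal_neq0 irr.
  by move=> x /(_ i).
rewrite card_eq_sym; apply: card_eq_trans card_II _; rewrite card_eq_sym.
by apply: inj_card_eq => i j _ _; exact: facet_inj.
Qed.

End Facets.

(** * Convexity and affine maps *)

Section AffineMaps.
Context {R : realType} {n : nat}.
Implicit Types (S V C : set 'rV[R]_n) (A : 'M[R]_n) (t x y : 'rV[R]_n).

Definition affine A t x : 'rV[R]_n := x *m A + t.

Lemma affine_comb A t (p : R) x y :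
  affine A t (p *: x + (1 - p) *: y) =
  p *: affine A t x + (1 - p) *: affine A t y.
Proof.
rewrite /affine mulmxDl -!scalemxAl !scalerDr addrACA -scalerDl.
by rewrite addrCA subrr addr0 scale1r.
Qed.

Lemma convex_setP C :
  @convex_set R 'rV[R]_n C <->
  forall p x y, 0 <= p -> p <= 1 -> C x -> C y -> C (p *: x + (1 - p) *: y).
Proof.
split=> [cC p x y p0 p1 xC yC|cC x y p /set_mem xC /set_mem yC].
  have /set_mem := cC x y (Itv01 p0 p1) (mem_set xC) (mem_set yC).
  exact.
by apply/mem_set; apply: cC.
Qed.

Lemma convex_hull_convex V : @convex_set R 'rV[R]_n (convex_hull V).
Proof.
apply/convex_setP => p x y p0 p1 xV yV C [cC VC].
by move/convex_setP: (cC); apply=> //; [exact: xV|exact: yV].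
Qed.

Lemma affine_preimage_convex A t C : @convex_set R 'rV[R]_n C ->
  @convex_set R 'rV[R]_n (affine A t @^-1` C).
Proof.
move=> /convex_setP cC; apply/convex_setP => p x y p0 p1 xC yC.
by rewrite /preimage /= affine_comb; apply: cC.
Qed.

Lemma affine_image_convex A t C : @convex_set R 'rV[R]_n C ->
  @convex_set R 'rV[R]_n (affine A t @` C).
Proof.
move=> /convex_setP cC; apply/convex_setP => p _ _ p0 p1 [x xC <-] [y yC <-].
by rewrite -affine_comb; exists (p *: x + (1 - p) *: y) => //; apply: cC.
Qed.

Lemma affine_image_hull A t V :
  affine A t @` convex_hull V = convex_hull (affine A t @` V).
Proof.
apply/seteqP; split.
  suff sub : convex_hull V `<=` affine A t @^-1` convex_hull (affine A t @` V).
    by move=> _ [x xV <-]; exact: sub.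
  apply: smallest_sub.
    exact/affine_preimage_convex/convex_hull_convex.
  by move=> x xV; apply: sub_gen_smallest; exists x.
apply: smallest_sub; first exact/affine_image_convex/convex_hull_convex.
by apply: image_subset; exact: sub_gen_smallest.
Qed.

Lemma segment_convex C x y :
  @convex_set R 'rV[R]_n C -> C x -> C y -> segment x y `<=` C.
Proof.
move=> /convex_setP cC xC yC z [p /=]; rewrite in_itv /= => /andP[p0 p1] <-.
have -> : x + p *: (y - x) = p *: y + (1 - p) *: x.
  by rewrite scalerBr scalerBl scale1r addrCA addrA.
exact: cC.
Qed.

Section Polyhedron.
Context {m : nat}.
Variables (u : 'I_m -> 'rV[R]_n) (b : 'I_m -> R) (A : 'M[R]_n) (t : 'rV[R]_n).
Hypothesis Au : A \in unitmx.

Definition affine_normal i := u i *m (invmx A)^T.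
Definition affine_bound i := b i + dot (affine_normal i) t.

(** The slack of each inequality is the same at a point and at its image. *)
Lemma dot_affine_normal i x :
  dot (affine_normal i) (affine A t x) = dot (u i) x + dot (affine_normal i) t.
Proof. by rewrite /affine dotDr {1}/affine_normal dotMl trmxK mulmxK. Qed.

Lemma affine_image_polyhedron :
  affine A t @` polyhedron u b = polyhedron affine_normal affine_bound.
Proof.
apply/seteqP; split=> [_ [x xP <-] i|y yP].
  by rewrite dot_affine_normal lerD2r.
have yE : affine A t ((y - t) *m invmx A) = y by rewrite /affine mulmxKV ?subrK.
exists ((y - t) *m invmx A) => // i.
by have := yP i; rewrite -{1}yE dot_affine_normal lerD2r.
Qed.

Lemma irredundant_affine :
  irredundant u b -> irredundant affine_normal affine_bound.
Proof.
move=> [[x xin] tight]; split.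
  by exists (affine A t x) => i; rewrite dot_affine_normal ltrD2r.
move=> i; have [y yi lt] := tight i; exists (affine A t y).
  by rewrite dot_affine_normal yi.
by move=> j ji; rewrite dot_affine_normal ltrD2r lt.
Qed.

Lemma boundary_affine_image : irredundant u b ->
  boundary (affine A t @` polyhedron u b) =
  affine A t @` boundary (polyhedron u b).
Proof.
move=> irr; have irr' := irredundant_affine irr.
have u0 i := tight_normal_neq0 i irr; have u0' i := tight_normal_neq0 i irr'.
rewrite affine_image_polyhedron // !boundary_polyhedron //.
rewrite -affine_image_polyhedron //; apply/seteqP; split.
  move=> _ [[x xP <-] [i]]; rewrite dot_affine_normal // => /addIr xi.
  by exists x => //; split=> //; exists i.
move=> _ [x [xP [i xi]] <-]; split; first by exists x.
by exists i; rewrite dot_affine_normal // xi.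
Qed.

End Polyhedron.

End AffineMaps.

(** * Orthogonal paths *)

Section OrthogonalPaths.
Context {R : realType} {n : nat}.
Implicit Types (S : set 'rV[R]_n) (x y z : 'rV[R]_n).

Lemma orthogonal_path_refl S x : orthogonal_path_in S x x.
Proof. by exists 0%N, (fun=> x). Qed.

Lemma segment_sym x y : segment x y = segment y x.
Proof.
suff sub (a c : 'rV[R]_n) : segment a c `<=` segment c a.
  by apply/seteqP; split; exact: sub.
move=> z [p /=]; rewrite in_itv /= => /andP[p0 p1] <-.
exists (1 - p); first by rewrite /= in_itv /= subr_ge0 p1 lerBlDr lerDl.
by apply/rowP => i; rewrite !mxE; ring.
Qed.

Lemma orthogonal_path_sym S x y :
  orthogonal_path_in S x y -> orthogonal_path_in S y x.
Proof.
move=> [k [p [p0 pk pS]]]; exists k, (fun i => p (k - i)%N).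
rewrite subn0 subnn; split=> // i ik.
have [|[j [c [c0 e]]] sS] := pS (k - i.+1)%N.
  by rewrite ltn_subrL; case: (k) ik.
rewrite -subSn // subSS in e sS; split; last by rewrite segment_sym.
by exists j, (- c); split; [rewrite oppr_eq0|rewrite scaleNr -e opprB].
Qed.

Lemma orthogonal_path_trans S y x z :
  orthogonal_path_in S x y -> orthogonal_path_in S y z ->
  orthogonal_path_in S x z.
Proof.
move=> [k [p [p0 pk pS]]] [l [q [q0 ql qS]]].
exists (k + l)%N, (fun i => if (i <= k)%N then p i else q (i - k)%N).
split; first by rewrite leq0n.
- case: leqP; rewrite ?addKn // -{2}[k]addn0 leq_add2l leqn0 => /eqP l0.
  by rewrite l0 addn0 pk -q0 -ql l0.
- move=> i ikl; case: (ltnP i k) => [ik|ki]; first by rewrite ltnW //; exact: pS.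
  have -> : (if (i <= k)%N then p i else q (i - k)%N) = q (i - k)%N.
    case: leqP => // ik; have -> : i = k by apply/eqP; rewrite eqn_leq ik.
    by rewrite subnn pk q0.
  by rewrite subSn //; apply: qS; rewrite ltn_subLR.
Qed.

(** The case c = 0 is allowed, so that a move need not be tested for being
    trivial. *)
Lemma orthogonal_path_step S x y i c :
  y - x = c *: delta_mx 0 i -> segment x y `<=` S -> orthogonal_path_in S x y.
Proof.
move=> e sS; have [c0|c0] := eqVneq c 0.
  move/eqP: e; rewrite c0 scale0r subr_eq0 => /eqP ->.
  exact: orthogonal_path_refl.
exists 1%N, (fun j => if j is 0%N then x else y); split=> // -[|//] _.
by split=> //; exists i, c.
Qed.

Lemma orthogonal_path_affine S (d t : 'rV[R]_n) x y :
  (forall i, d 0 i != 0) -> orthogonal_path_in S x y ->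
  orthogonal_path_in (affine (diag_mx d) t @` S)
    (affine (diag_mx d) t x) (affine (diag_mx d) t y).
Proof.
move=> d0 [k [p [p0 pk pS]]]; exists k, (affine (diag_mx d) t \o p).
split=> /=; rewrite ?p0 ?pk // => i ik; have [[j [c [c0 e]]] sS] := pS i ik.
split.
  exists j, (c * d 0 j); split; first by rewrite mulf_neq0.
  rewrite /affine opprD addrACA subrr addr0 -mulmxBl e -scalemxAl -rowE.
  by rewrite row_diag_mx scalerA.
move=> _ [q q01 <-]; exists (p i + q *: (p i.+1 - p i)); first by apply: sS; exists q.
rewrite /affine mulmxDl -scalemxAl mulmxBl addrAC; congr (_ + _ *: _).
by rewrite opprD addrACA subrr addr0.
Qed.

(** A facet is convex, so a move inside it only needs to be checked at its
    ends. *)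
Lemma facet_step m (u : 'I_m -> 'rV[R]_n) b i x y j c :
  (forall i, u i != 0) -> facet u b i x -> facet u b i y ->
  y - x = c *: delta_mx 0 j ->
  orthogonal_path_in (boundary (polyhedron u b)) x y.
Proof.
move=> u0 [xP xi] [yP yi] e; apply: orthogonal_path_step e _.
rewrite boundary_polyhedron // => z zs; split.
  by move: z zs; apply: segment_convex => //; exact: polyhedron_convex.
exists i; case: zs => p _ <-.
by rewrite dotDr dotZr dotDr dotNr xi yi subrr mulr0 addr0.
Qed.

Lemma orthogonally_connected_star S o :
  (forall x, S x -> orthogonal_path_in S x o) -> orthogonally_connected S.
Proof.
move=> star x y xS yS _.
by apply: orthogonal_path_trans (orthogonal_path_sym (star y yS)); exact: star.
Qed.

Lemma orthogonally_connected_affine S (d t : 'rV[R]_n) :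
  (forall i, d 0 i != 0) -> orthogonally_connected S ->
  orthogonally_connected (affine (diag_mx d) t @` S).
Proof.
move=> d0 cS _ _ [x xS <-] [y yS <-] ne; apply: orthogonal_path_affine => //.
by apply: cS => //; apply: contra_neq ne => ->.
Qed.

End OrthogonalPaths.

(** * The quarter of the truncated octahedron *)

Section QuarterOctahedron.
Context {R : realType}.
Implicit Types (a b c x y z : R).

Definition vec3 a b c : 'rV[R]_3 := \row_i [:: a; b; c]`_i.

Lemma vec3E (x : 'rV[R]_3) :
  x = vec3 (x 0 0) (x 0 (lift ord0 ord0)) (x 0 ord_max).
Proof.
apply/rowP => i; rewrite mxE.
by case: i => [[|[|[|//]]] ?] /=; congr (x 0 _); apply/val_inj.
Qed.

Lemma eq_vec3 a b c a' b' c' : a = a' -> b = b' -> c = c' ->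
  vec3 a b c = vec3 a' b' c'.
Proof. by move=> -> -> ->. Qed.

Lemma addv3 a b c a' b' c' :
  vec3 a b c + vec3 a' b' c' = vec3 (a + a') (b + b') (c + c').
Proof. by apply/rowP => -[[|[|[|//]]] ?]; rewrite !mxE. Qed.

Lemma scalev3 p a b c : p *: vec3 a b c = vec3 (p * a) (p * b) (p * c).
Proof. by apply/rowP => -[[|[|[|//]]] ?]; rewrite !mxE. Qed.

Lemma dotv3 a b c a' b' c' :
  dot (vec3 a b c) (vec3 a' b' c') = a * a' + b * b' + c * c'.
Proof. by rewrite /dot !big_ord_recr big_ord0 !mxE /= add0r. Qed.

Lemma convex_combination_between a c x : a <= x <= c ->
  exists2 p, 0 <= p <= 1 & x = p * a + (1 - p) * c.
Proof.
move=> /andP[ax xc]; have [e|ne] := eqVneq a c.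
  by exists 0; lra.
have h : 0 < c - a by rewrite subr_gt0 lt_neqAle ne (le_trans ax).
exists ((c - x) / (c - a)); last by field; rewrite gt_eqF.
by rewrite ler_pdivlMr // ler_pdivrMr //; lra.
Qed.

Lemma convex_vec3 (C : set 'rV[R]_3) p a b c a' b' c' x y z :
  @convex_set R 'rV[R]_3 C -> 0 <= p <= 1 ->
  C (vec3 a b c) -> C (vec3 a' b' c') ->
  x = p * a + (1 - p) * a' -> y = p * b + (1 - p) * b' ->
  z = p * c + (1 - p) * c' -> C (vec3 x y z).
Proof.
move=> /convex_setP cC /andP[p0 p1] Ca Ca' -> -> ->.
by have := cC p _ _ p0 p1 Ca Ca'; rewrite !scalev3 addv3.
Qed.

(** The inequalities X >= 0, Z >= 0, Z <= 2, X + Z <= 3, Y + Z <= 3,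
    Z - Y <= 3, X + Y <= 4, X - Y <= 4, in this order. *)
Definition quarter_normal (i : 'I_8) : 'rV[R]_3 := nth 0
  [:: vec3 (-1) 0 0; vec3 0 0 (-1); vec3 0 0 1; vec3 1 0 1;
      vec3 0 1 1; vec3 0 (-1) 1; vec3 1 1 0; vec3 1 (-1) 0] i.

Definition quarter_bound (i : 'I_8) : R := [:: 0; 0; 2; 3; 3; 3; 4; 4]`_i.

Definition quarter : set 'rV[R]_3 := polyhedron quarter_normal quarter_bound.

Lemma quarterP a b c : quarter (vec3 a b c) <->
  [/\ [/\ 0 <= a, 0 <= c, c <= 2 & a + c <= 3],
      b + c <= 3, c - b <= 3, a + b <= 4 & a - b <= 4].
Proof.
split=> [h|[[h1 h2 h3 h4] h5 h6 h7 h8] i].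
  have g k (lt : (k < 8)%N) := h (Ordinal lt).
  have := (g 0%N isT, g 1%N isT, g 2%N isT, g 3%N isT,
    (g 4%N isT, g 5%N isT, g 6%N isT, g 7%N isT)).
  rewrite /quarter_normal /quarter_bound /= !dotv3 => -[[[[? ?] ?] ?] [[[? ?] ?] ?]].
  by do ![split]; lra.
case: i => [[|[|[|[|[|[|[|[|//]]]]]]]] ?];
  rewrite /quarter_normal /quarter_bound /= dotv3; lra.
Qed.

Lemma irredundant_quarter : irredundant quarter_normal quarter_bound.
Proof.
split.
  exists (vec3 1 0 1); rewrite /quarter_normal /quarter_bound.
  by case=> [[|[|[|[|[|[|[|[|//]]]]]]]] ?] /=; rewrite dotv3; lra.
(* A point in the relative interior of each of the eight facets. *)
pose w := [:: vec3 0 0 1; vec3 1 0 0; vec3 (1/2) 0 2; vec3 2 0 1;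
  vec3 1 2 1; vec3 1 (-2) 1; vec3 2 2 (1/2); vec3 2 (-2) (1/2)].
move=> i; exists (nth 0 w i); rewrite /w /quarter_normal /quarter_bound.
  by case: i => [[|[|[|[|[|[|[|[|//]]]]]]]] ?] /=; rewrite dotv3; lra.
case: i => [[|[|[|[|[|[|[|[|//]]]]]]]] ?];
case=> [[|[|[|[|[|[|[|[|//]]]]]]]] ?] //= _; rewrite dotv3; lra.
Qed.

Definition sign (s : R) : Prop := s = 1 \/ s = -1.

Lemma quarter_normal_neq0 i : quarter_normal i != 0.
Proof. exact: tight_normal_neq0 irredundant_quarter. Qed.

(** The assumption on C says that it contains the twelve vertices, the sign [s]
    being the one of Y.  Each point of the piece is on the segment
    parallel to Y between the points where |Y| = min (3 - Z, 4 - X).  On the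
    face |Y| + Z = 3 (resp. X + |Y| = 4), a segment parallel to the
    XY-plane joins two edges, whose ends are vertices. *)
Lemma quarter_sub_convex (C : set 'rV[R]_3) : @convex_set R 'rV[R]_3 C ->
  (forall s, sign s ->
    [/\ C (vec3 0 s 2), C (vec3 1 s 2) & C (vec3 2 (s * 2) 1)] /\
    [/\ C (vec3 0 (s * 3) 0), C (vec3 1 (s * 3) 0) & C (vec3 3 s 0)]) ->
  quarter `<=` C.
Proof.
move=> cC vC x; rewrite (vec3E x); move: (x 0 _) (x 0 _) (x 0 _) => {x} z y x.
move=> /quarterP[[x0 z0 z2 xz] yz yz' xy xy'].
have top s : sign s -> C (vec3 x (s * Num.min (3 - z) (4 - x)) z).
  move=> /vC[[v1 v2 v3] [v4 v5 v6]].
  have left : C (vec3 0 (s * (3 - z)) z).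
    by apply: (convex_vec3 (p := z / 2) cC _ v1 v4); [lra|field..].
  have right : z <= 1 -> C (vec3 (3 - z) (s * (1 + z)) z).
    by move=> z1; apply: (convex_vec3 (p := z) cC _ v3 v6); [lra|ring..].
  have mid : z <= 1 -> C (vec3 (1 + z) (s * (3 - z)) z).
    by move=> z1; apply: (convex_vec3 (p := z) cC _ v3 v5); [lra|ring..].
  have mid' : 1 <= z -> C (vec3 (3 - z) (s * (3 - z)) z).
    by move=> z1; apply: (convex_vec3 (p := z - 1) cC _ v2 v3); [lra|ring..].
  have mids w : C (vec3 w (s * (3 - z)) z) -> x <= w -> C (vec3 x (s * (3 - z)) z).
    move=> Cw xw; have [|p p01 xE] := @convex_combination_between 0 w x.
      by rewrite x0.
    by apply: (convex_vec3 cC p01 left Cw); [|ring..].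
  case: (leP (3 - z) (4 - x)) => h.
    by case: (leP z 1) => z1; [apply: mids (mid z1) _|apply: mids (mid' (ltW z1)) _];
      lra.
  have z1 : z <= 1 by lra.
  have [|p p01 xE] := @convex_combination_between (1 + z) (3 - z) x; first by lra.
  by apply: (convex_vec3 cC p01 (mid z1) (right z1)); [by []|rewrite xE; ring|ring].
have [|p p01 yE] := @convex_combination_between
    (-1 * Num.min (3 - z) (4 - x)) (1 * Num.min (3 - z) (4 - x)) y.
  by case: (leP (3 - z) (4 - x)) => h; lra.
by apply: (convex_vec3 cC p01 (top _ (or_intror erefl)) (top _ (or_introl erefl)));
  rewrite // ; ring.
Qed.

Lemma polytope_quarter : polytope quarter.
Proof.
split; last first.
  rewrite interior_polyhedron; last exact: quarter_normal_neq0.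
  by case: irredundant_quarter.
pose V : seq 'rV[R]_3 :=
  flatten [seq [:: vec3 0 s 2; vec3 1 s 2; vec3 2 (s * 2) 1;
                   vec3 0 (s * 3) 0; vec3 1 (s * 3) 0; vec3 3 s 0]
          | s <- [:: 1; -1]].
exists [set` V]; first exact: finite_seq.
apply/seteqP; split.
  apply: quarter_sub_convex; first exact: convex_hull_convex.
  move=> s s1.
  by do ![split]; apply: sub_gen_smallest; rewrite /V /= !inE;
     case: s1 => ->; rewrite eqxx ?orbT.
apply: smallest_sub; first exact: polyhedron_convex.
move=> v; rewrite /V /= !inE; do ![case/orP]; move=> /eqP ->;
  by apply/quarterP; do ![split]; lra.
Qed.

Lemma quarter_stepX (i : 'I_8) a b c a' :
  quarter (vec3 a b c) -> quarter (vec3 a' b c) ->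
  dot (quarter_normal i) (vec3 a b c) = quarter_bound i ->
  dot (quarter_normal i) (vec3 a' b c) = quarter_bound i ->
  orthogonal_path_in (boundary quarter) (vec3 a b c) (vec3 a' b c).
Proof.
move=> O O' e e'; apply: (@facet_step _ _ _ _ _ i _ _ 0 (a' - a)) => //.
  exact: quarter_normal_neq0.
by apply/rowP => -[[|[|[|//]]] ?]; rewrite !mxE /=; ring.
Qed.

Lemma quarter_stepY (i : 'I_8) a b c b' :
  quarter (vec3 a b c) -> quarter (vec3 a b' c) ->
  dot (quarter_normal i) (vec3 a b c) = quarter_bound i ->
  dot (quarter_normal i) (vec3 a b' c) = quarter_bound i ->
  orthogonal_path_in (boundary quarter) (vec3 a b c) (vec3 a b' c).
Proof.
move=> O O' e e'; apply: (@facet_step _ _ _ _ _ i _ _ (lift ord0 ord0) (b' - b)) => //.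
  exact: quarter_normal_neq0.
by apply/rowP => -[[|[|[|//]]] ?]; rewrite !mxE /=; ring.
Qed.

Lemma quarter_stepZ (i : 'I_8) a b c c' :
  quarter (vec3 a b c) -> quarter (vec3 a b c') ->
  dot (quarter_normal i) (vec3 a b c) = quarter_bound i ->
  dot (quarter_normal i) (vec3 a b c') = quarter_bound i ->
  orthogonal_path_in (boundary quarter) (vec3 a b c) (vec3 a b c').
Proof.
move=> O O' e e'; apply: (@facet_step _ _ _ _ _ i _ _ ord_max (c' - c)) => //.
  exact: quarter_normal_neq0.
by apply/rowP => -[[|[|[|//]]] ?]; rewrite !mxE /=; ring.
Qed.

Local Ltac quarter_tac := solve [apply/quarterP; (do 5? split); lra
  | (rewrite /quarter_normal /quarter_bound /= dotv3; lra)].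

Lemma boundary_quarter_connected : orthogonally_connected (boundary quarter).
Proof.
pose F k (lt : (k < 8)%N) := Ordinal lt.
have wallX y z : quarter (vec3 0 y z) ->
    orthogonal_path_in (boundary quarter) (vec3 0 y z) (vec3 0 0 0).
  move=> O; have /quarterP[[_ z0 z2 _] yz yz' _ _] := O.
  apply: (@orthogonal_path_trans _ _ _ (vec3 0 y 0)).
    by apply: (@quarter_stepZ (F 0%N isT)); quarter_tac.
  by apply: (@quarter_stepY (F 0%N isT)); quarter_tac.
have floorZ x y : quarter (vec3 x y 0) ->
    orthogonal_path_in (boundary quarter) (vec3 x y 0) (vec3 0 0 0).
  move=> O; have /quarterP[[x0 _ _ x3] y3 y3' xy xy'] := O.
  apply: (@orthogonal_path_trans _ _ _ (vec3 x 0 0)).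
    by apply: (@quarter_stepY (F 1%N isT)); quarter_tac.
  by apply: (@quarter_stepX (F 1%N isT)); quarter_tac.
apply: (@orthogonally_connected_star _ _ _ (vec3 0 0 0)) => v.
have := boundary_polyhedron quarter_bound quarter_normal_neq0.
move/seteqP => [/(_ v) sub _] /sub{sub}.
rewrite (vec3E v); move: (v _ _) (v _ _) (v _ _) => {v} z y x [vO [i]].
have /quarterP[[x0 z0 z2 xz] yz yz' xy xy'] := vO.
case: i => [[|[|[|[|[|[|[|[|//]]]]]]]] lt] /=;
  rewrite {1}/quarter_normal {1}/quarter_bound /= dotv3 => e.
- have x_0 : x = 0 by lra.
  by move: vO; rewrite x_0; exact: wallX.
- have z_0 : z = 0 by lra.
  by move: vO; rewrite z_0; exact: floorZ.
- apply: (orthogonal_path_trans _ (wallX y z _)); last by quarter_tac.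
  by apply: (@quarter_stepX (F 2%N isT)); quarter_tac.
- (* The face X + Z = 3 meets Y + Z = 3 where X <= 2, and X + Y = 4 where
     X >= 2. *)
  have [x2|x2] := leP x 2.
    apply: (@orthogonal_path_trans _ _ _ (vec3 x x z)).
      by apply: (@quarter_stepY (F 3%N isT)); quarter_tac.
    apply: (orthogonal_path_trans _ (wallX x z _)); last by quarter_tac.
    by apply: (@quarter_stepX (F 4%N isT)); quarter_tac.
  apply: (@orthogonal_path_trans _ _ _ (vec3 x (4 - x) z)).
    by apply: (@quarter_stepY (F 3%N isT)); quarter_tac.
  apply: (orthogonal_path_trans _ (floorZ x (4 - x) _)); last by quarter_tac.
  by apply: (@quarter_stepZ (F 6%N isT)); quarter_tac.
- apply: (orthogonal_path_trans _ (wallX y z _)); last by quarter_tac.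
  by apply: (@quarter_stepX (F 4%N isT)); quarter_tac.
- apply: (orthogonal_path_trans _ (wallX y z _)); last by quarter_tac.
  by apply: (@quarter_stepX (F 5%N isT)); quarter_tac.
- apply: (orthogonal_path_trans _ (floorZ x y _)); last by quarter_tac.
  by apply: (@quarter_stepZ (F 6%N isT)); quarter_tac.
- apply: (orthogonal_path_trans _ (floorZ x y _)); last by quarter_tac.
  by apply: (@quarter_stepZ (F 7%N isT)); quarter_tac.
Qed.

End QuarterOctahedron.

(** * The pieces *)

Section Pieces.
Context {R : realType}.
Variables (d t : 'rV[R]_3).
Hypothesis d0 : forall i, d 0 i != 0.

Lemma diag_mx_unit : diag_mx d \in unitmx.
Proof. by rewrite unitmxE det_diag unitfE; apply/prodf_neq0 => i _. Qed.

Definition piece : set 'rV[R]_3 := affine (diag_mx d) t @` quarter.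

Lemma piece_polyhedron : piece = polyhedron
  (affine_normal quarter_normal (diag_mx d)) (affine_bound quarter_normal quarter_bound (diag_mx d) t).
Proof. exact: affine_image_polyhedron diag_mx_unit. Qed.

Let irr := irredundant_affine t diag_mx_unit (@irredundant_quarter R).

Lemma polytope_piece : polytope piece.
Proof.
split.
  have [[V fV quarterV] _] := @polytope_quarter R.
  exists (affine (diag_mx d) t @` V); first exact: finite_image.
  by rewrite -affine_image_hull -quarterV.
rewrite piece_polyhedron interior_polyhedron; first by case: irr.
by move=> i; exact: tight_normal_neq0 irr.
Qed.

Lemma octahedron_piece : octahedron piece.
Proof.
split; first exact: polytope_piece.
by rewrite piece_polyhedron; exact: card_faces_polyhedron irr.
Qed.

Lemma boundary_piece_connected : orthogonally_connected (boundary piece).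
Proof.
rewrite /piece (boundary_affine_image _ diag_mx_unit irredundant_quarter).
exact/orthogonally_connected_affine/boundary_quarter_connected.
Qed.

(** The two strict inequalities are those that separate the pieces from each
    other. *)
Lemma interior_piece :
  interior piece `<=`
  affine (diag_mx d) t @` [set x : 'rV[R]_3 | 0 < x 0 0 /\ 0 < x 0 ord_max].
Proof.
rewrite piece_polyhedron interior_polyhedron; last by move=> i; exact: tight_normal_neq0 irr.
move=> y yin; pose x := (y - t) *m invmx (diag_mx d).
have yE : affine (diag_mx d) t x = y.
  by rewrite /affine mulmxKV ?subrK // diag_mx_unit.
exists x => //; have xin i : dot (quarter_normal i) x < quarter_bound i.
  by have := yin i; rewrite -yE dot_affine_normal ?diag_mx_unit // ltrD2r.
have := (xin (Ordinal (isT : (0 < 8)%N)), xin (Ordinal (isT : (1 < 8)%N))).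
rewrite (vec3E x) /quarter_normal /quarter_bound /= !dotv3 !mxE /= => -[].
by split; lra.
Qed.

End Pieces.

(** * The standard truncated octahedron *)

Section StandardTruncatedOctahedron.
Context {R : realType}.
Implicit Types (s p q : R) (x y : 'rV[R]_3).

Local Notation std := (@std_truncated_octahedron R).

Definition std_vertex : set 'rV[R]_3 := [set v | exists (s : 'S_3) (a b : bool),
  v = col_perm s (\row_(i < 3) [:: 0; (-1) ^+ a; (-1) ^+ b * 2]`_i)].

Lemma signP s : sign s -> exists a : bool, s = (-1) ^+ a.
Proof. by case=> ->; [exists false|exists true]; rewrite ?expr0 ?expr1. Qed.

Lemma std_vertex_perm (s : 'S_3) x : std_vertex x -> std_vertex (col_perm s x).
Proof. by move=> [s' [a [b ->]]]; exists (s * s')%g, a, b; rewrite col_permM. Qed.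

Lemma std_vertex_swap01 a b c :
  std_vertex (vec3 a b c) -> std_vertex (vec3 b a c).
Proof.
move=> /(std_vertex_perm (tperm 0 (lift ord0 ord0))).
suff -> : col_perm (tperm 0 (lift ord0 ord0)) (vec3 a b c) = vec3 b a c by [].
by rewrite [LHS]vec3E; apply: eq_vec3; rewrite !mxE ?tpermL ?tpermR ?tpermD.
Qed.

Lemma std_vertex_swap12 a b c :
  std_vertex (vec3 a b c) -> std_vertex (vec3 a c b).
Proof.
move=> /(std_vertex_perm (tperm (lift ord0 ord0) ord_max)).
suff -> : col_perm (tperm (lift ord0 ord0) ord_max) (vec3 a b c) = vec3 a c b by [].
by rewrite [LHS]vec3E; apply: eq_vec3; rewrite !mxE ?tpermL ?tpermR ?tpermD.
Qed.

Lemma std_vertices p q : sign p -> sign q ->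
  [/\ std (vec3 0 p (q * 2)), std (vec3 p 0 (q * 2)) & std (vec3 0 (q * 2) p)] /\
  [/\ std (vec3 (q * 2) 0 p), std (vec3 p (q * 2) 0) & std (vec3 (q * 2) p 0)].
Proof.
move=> /signP[a pE] /signP[b qE].
have v1 : std_vertex (vec3 0 p (q * 2)).
  by exists 1%g, a, b; rewrite col_perm1 pE qE.
have v2 := std_vertex_swap01 v1; have v3 := std_vertex_swap12 v1.
have v4 := std_vertex_swap01 v3; have v5 := std_vertex_swap12 v2.
have v6 := std_vertex_swap01 v5.
by do ![split]; apply: sub_gen_smallest.
Qed.

Lemma std_bound : std `<=` [set x | (forall i, `|x 0 i| <= 2) /\ \sum_i `|x 0 i| <= 3].
Proof.
apply: smallest_sub.
  apply/convex_setP => p x y p0 p1 [x2 x3] [y2 y3].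
  have comb i : `|(p *: x + (1 - p) *: y) 0 i| <= p * `|x 0 i| + (1 - p) * `|y 0 i|.
    rewrite !mxE (le_trans (ler_normD _ _)) // !normrM (ger0_norm p0).
    by rewrite (@ger0_norm _ (1 - p)) // subr_ge0.
  split=> [i|]; first by apply: le_trans (comb i) _; have := x2 i; have := y2 i; nra.
  apply: le_trans (ler_sum _ (fun i _ => comb i)) _.
  by rewrite big_split -!mulr_sumr /=; nra.
move=> _ [s [a [b ->]]]; split.
  move=> i; rewrite !mxE; case: (s i) => [[|[|[|//]]] ?] /=.
  - by rewrite normr0.
  - by rewrite normrX normrN1 expr1n ler1n.
  - by rewrite normrM normrX normrN1 expr1n mul1r ger0_norm.
pose w : 'rV[R]_3 := \row_(i < 3) [:: 0; (-1) ^+ a; (-1) ^+ b * 2]`_i.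
rewrite (eq_bigr (fun i => `|w 0 (s i)|)); last by move=> i _; rewrite /w !mxE.
have <- : \sum_i `|w 0 i| = \sum_i `|w 0 (s i)| by rewrite [LHS](reindex_perm s).
rewrite !big_ord_recr big_ord0 !mxE /= normr0 normrM !normrX normrN1 !expr1n.
by rewrite ger0_norm //; lra.
Qed.

(** The coordinates X, Y, Z whose axes are the directions of the paths. *)
Definition frame x : 'rV[R]_3 :=
  vec3 (x 0 0 + x 0 (lift ord0 ord0)) (x 0 0 - x 0 (lift ord0 ord0)) (x 0 ord_max).

Definition flip s s' x : 'rV[R]_3 :=
  vec3 (s * x 0 0) (x 0 (lift ord0 ord0)) (s' * x 0 ord_max).

Lemma frame_std_sub_quarter x : std x ->
  exists s s', [/\ sign s, sign s' & quarter (flip s s' (frame x))].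
Proof.
rewrite (vec3E x) => /std_bound[/= x2]; move: (x2 0) (x2 (lift ord0 ord0)) (x2 ord_max).
rewrite !big_ord_recr big_ord0 /flip /frame !mxE /= add0r {x2}.
move: (x 0 _) (x 0 _) (x 0 _) => {x} c b a.
have := (ler_norm a, ler_norm b, ler_norm c).
have := (ler_norm (- a), ler_norm (- b), ler_norm (- c)).
rewrite !normrN => -[[? ?] ?] [[? ?] ?] ? ? ? ?.
exists (if 0 <= a + b then 1 else -1), (if 0 <= c then 1 else -1).
split; try by case: ifP => _; rewrite /sign; auto.
by case: (lerP 0 c) => ?; case: (lerP 0 (a + b)) => ?; apply/quarterP; do ![split]; lra.
Qed.

(** The preimages under [frame] of the vertices of the pieces are either
    vertices of the truncated octahedron, or midpoints of two of them. *)
Lemma quarter_sub_frame_std s s' y : sign s -> sign s' -> quarter y ->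
  exists2 x, std x & frame x = flip s s' y.
Proof.
move=> hs hs'.
pose g y := vec3 ((s * y 0 0 + y 0 (lift ord0 ord0)) / 2)
  ((s * y 0 0 - y 0 (lift ord0 ord0)) / 2) (s' * y 0 ord_max).
have gE a b c : g (vec3 a b c) = vec3 ((s * a + b) / 2) ((s * a - b) / 2) (s' * c).
  by rewrite /g !mxE.
suff sub : quarter `<=` g @^-1` std.
  move=> /sub gy; exists (g y) => //.
  by rewrite /frame /flip !mxE /=; apply: eq_vec3; field.
have std_convex : @convex_set R 'rV[R]_3 std by exact: convex_hull_convex.
apply: quarter_sub_convex.
  apply/convex_setP => p x z p0 p1 xC zC.
  have gpxz : g (p *: x + (1 - p) *: z) = p *: g x + (1 - p) *: g z.
    by rewrite /g !scalev3 addv3 !mxE; apply: eq_vec3; field.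
  by rewrite /preimage /= gpxz; move/convex_setP: std_convex; apply.
move=> u hu; rewrite /preimage /= !gE.
have hN (r : R) : sign r -> sign (- r).
  by case=> ->; rewrite /sign ?opprK; auto.
have half : 0 <= (1 / 2 : R) <= 1 by lra.
have su : s = u \/ s = - u.
  by case: hs hu => -> [] ->; rewrite ?opprK; auto.
have [[a1 a2 _] _] := std_vertices (hN _ hu) hs'.
have [[_ b2 _] _] := std_vertices hu hs'.
have [_ [c4 _ _]] := std_vertices hs' hu.
have [_ [_ _ d6]] := std_vertices hu hu.
have [_ [_ _ e6]] := std_vertices (hN _ hu) hu.
have [_ [_ f5 _]] := std_vertices hu (hN _ hu).
have [[_ _ g3] _] := std_vertices hs' (hN _ hu).
have [_ [_ h5 _]] := std_vertices (hN _ hu) (hN _ hu).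
have cast a b c a' b' c' : std (vec3 a b c) ->
   a = a' -> b = b' -> c = c' -> std (vec3 a' b' c').
  by move=> + <- <- <-.
do ![split].
- by apply: (convex_vec3 std_convex half b2 a1); field.
- by case: su => ->; [apply: (cast _ _ _ _ _ _ b2)|apply: (cast _ _ _ _ _ _ a1)]; field.
- by case: su => ->; [apply: (cast _ _ _ _ _ _ c4)|apply: (cast _ _ _ _ _ _ g3)]; field.
- by apply: (convex_vec3 std_convex half f5 e6); field.
- by case: su => ->; [apply: (cast _ _ _ _ _ _ e6)|apply: (cast _ _ _ _ _ _ f5)]; field.
- by case: su => ->; [apply: (cast _ _ _ _ _ _ d6)|apply: (cast _ _ _ _ _ _ h5)]; field.
Qed.

End StandardTruncatedOctahedron.

(** * The decomposition *)

Section EighthTurn.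
Context {R : realType}.

Local Notation r := (Num.sqrt 2 : R).

(** The change to the coordinates X, Y, Z, rescaled so as to be orthogonal. *)
Definition diagonal_frame : 'M[R]_3 := \matrix_(i < 3)
  [:: vec3 r^-1 r^-1 0; vec3 r^-1 (- r^-1) 0; vec3 0 0 1]`_i.

Lemma mul_diagonal_frame (x : 'rV[R]_3) :
  x *m diagonal_frame = frame x *m diag_mx (vec3 r^-1 r^-1 1).
Proof.
rewrite mul_mx_diag; apply/rowP => j; rewrite !mxE !big_ord_recr big_ord0 !mxE /=.
rewrite (vec3E x) !mxE /=.
by case: j => [[|[|[|//]]] ?] /=; ring.
Qed.

Lemma diagonal_frame_orthogonal : orthogonal_mx diagonal_frame.
Proof.
have r2 : r^-1 * r^-1 = 1 / 2 :> R.
  by rewrite -invfM -expr2 sqr_sqrtr // div1r.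
apply/matrixP => i j; rewrite !mxE !big_ord_recr big_ord0 !mxE /=.
by case: i => [[|[|[|//]]] ?]; case: j => [[|[|[|//]]] ?] /=;
  rewrite !mxE /= ?mulrN ?mulNr ?opprK ?r2; lra.
Qed.

Lemma det_orthogonal n (Q : 'M[R]_n) : orthogonal_mx Q -> \det Q ^+ 2 = 1.
Proof. by move=> QQ; rewrite expr2 -{2}(det_tr Q) -det_mulmx QQ det1. Qed.

End EighthTurn.

Theorem theorem5p6 (R : realType) (T : set 'rV[R]_3)
    (hT : truncated_octahedron T) :
  exists Q : 'M[R]_3, rotation_mx Q /\
    exists P : 'I_4 -> set 'rV[R]_3,
      decomposed_into [set x *m Q | x in T] P /\
      (forall i, octahedron (P i) /\ orthogonally_connected (boundary (P i))).
Proof.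
have [c [Q0 [t [c0 Q0orth ->]]]] := hT.
pose B : 'M[R]_3 := diagonal_frame.
have Borth : orthogonal_mx B := diagonal_frame_orthogonal.
(* In odd dimension, the sign e makes the determinant of Q equal to 1; like
   the scale c, it is absorbed in the diagonal maps d i defining the pieces. *)
pose e := \det Q0 * \det B.
have e2 : e ^+ 2 = 1 by rewrite exprMn !det_orthogonal // mulr1.
have e0 : e != 0 by rewrite -sqrf_eq0 e2 oner_eq0.
have Q0orth' : Q0^T *m Q0 = 1%:M by apply: mulmx1C.
pose Q := e *: (Q0^T *m B).
have QE x : (c *: (x *m Q0) + t) *m Q = (e * c) *: (x *m B) + t *m Q.
  rewrite mulmxDl; congr (_ + _); rewrite /Q -scalemxAr -scalemxAl scalerA.
  by rewrite mulmxA -[x *m Q0 *m _]mulmxA Q0orth mulmx1.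
exists Q; split.
  split.
    rewrite /orthogonal_mx /Q linearZ /= -scalemxAl -scalemxAr scalerA -expr2 e2 scale1r.
    by rewrite trmx_mul trmxK mulmxA -[_ *m B *m _]mulmxA Borth mulmx1.
  rewrite /Q detZ det_mulmx det_tr -/e.
  by rewrite exprS e2 mulr1 -expr2 e2.
pose r : R := Num.sqrt 2.
have r0 : r != 0 by rewrite gt_eqF // sqrtr_gt0.
have ec0 : e * c != 0 by rewrite mulf_neq0 // gt_eqF.
(* The two binary digits of i select the signs of X and Z. *)
pose s1 (i : 'I_4) : R := (-1) ^+ odd i.
pose s2 (i : 'I_4) : R := (-1) ^+ (2 <= i)%N.
pose d i := vec3 (s1 i * (e * c / r)) (e * c / r) (s2 i * (e * c)).
have d0 i j : d i 0 j != 0.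
  have ecr0 : e * c / r != 0 by rewrite mulf_neq0 // invr_eq0.
  by rewrite /d mxE; case: j => [[|[|[|//]]] ?] //=; rewrite mulf_neq0 // signr_eq0.
have dE i y : affine (diag_mx (d i)) (t *m Q) y =
    (e * c) *: (flip (s1 i) (s2 i) y *m diag_mx (vec3 r^-1 r^-1 1)) + t *m Q.
  rewrite /affine !mul_mx_diag; congr (_ + _); rewrite (vec3E y) /flip.
  by apply/rowP => -[[|[|[|//]]] ?]; rewrite !mxE /=; ring.
have sS i : sign (s1 i) /\ sign (s2 i).
  by split; rewrite /s1 /s2 -signr_odd; case: odd; rewrite /sign ?expr0 ?expr1; auto.
have flipK i y : flip (s1 i) (s2 i) (flip (s1 i) (s2 i) y) = y.
  rewrite [RHS]vec3E /flip !mxE /= !mulrA -!expr2 /s1 /s2 !sqrr_sign !mul1r.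
  by [].
exists (fun i => piece (d i) (t *m Q)); split; last first.
  by move=> i; split; [exact: octahedron_piece|exact: boundary_piece_connected].
split; first by move=> i; exact: polytope_piece.
  apply/seteqP; split.
    move=> _ [_ [x xS <-] <-]; rewrite QE mul_diagonal_frame.
    have [s [s' [hs hs' inO]]] := frame_std_sub_quarter xS.
    have [i [si s'i]] : exists i : 'I_4, s = s1 i /\ s' = s2 i.
      case: hs hs' => -> [] ->.
      - by exists (@Ordinal 4 0 isT); rewrite /s1 /s2 /= !expr0.
      - by exists (@Ordinal 4 2 isT); rewrite /s1 /s2 /= !expr0 !expr1.
      - by exists (@Ordinal 4 1 isT); rewrite /s1 /s2 /= !expr0 !expr1.
      - by exists (@Ordinal 4 3 isT); rewrite /s1 /s2 /= !expr1.
    exists i => //; exists (flip (s1 i) (s2 i) (frame x)); first by rewrite -si -s'i.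
    by rewrite dE flipK.
  move=> _ [i _ [y yO <-]]; have [hs hs'] := sS i.
  have [x xS xE] := quarter_sub_frame_std hs hs' yO.
  exists (c *: (x *m Q0) + t); first by exists x.
  by rewrite QE mul_diagonal_frame dE xE.
(* Interior points of distinct pieces differ in the sign of X or Z. *)
apply/trivIsetP => i j _ _ /eqP ij; rewrite -subset0 => z [zi zj].
have [x [x0 x2] xz] := interior_piece (d0 i) zi.
have [y [y0 y2] yz] := interior_piece (d0 j) zj.
apply: ij.
have /rowP eqxy : flip (s1 i) (s2 i) x = flip (s1 j) (s2 j) y.
  have w0 k : vec3 r^-1 r^-1 1 0 k != 0.
    by rewrite mxE; case: k => [[|[|[|//]]] ?] /=; rewrite ?invr_eq0 ?oner_eq0.
  apply: (can_inj (mulmxK (diag_mx_unit w0))); apply: (scalerI ec0).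
  by move: xz; rewrite -yz !dE => /addIr.
have := eqxy 0; have := eqxy ord_max; rewrite !mxE /=.
move: x0 x2 y0 y2; rewrite /s1 /s2.
move: (x 0 0) (x 0 ord_max) (y 0 0) (y 0 ord_max) => a b a' b' a0 b0 a0' b0'.
case: i {zi xz d0 dE sS flipK eqxy} => [[|[|[|[|//]]]] ?];
case: j {zj yz} => [[|[|[|[|//]]]] ?]; rewrite /= ?expr0 ?expr1 => h1 h2;
  by [apply/val_inj | exfalso; lra].
Qed.
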